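(* Let $t\ge 2$ and let $S(t)=\Bbbk[x_1,y_1]\#\cdots\#\Bbbk[x_t,y_t]$ be the Segre product of $t$ polynomial rings in two variables over an algebraically closed field $\Bbbk$ of positive characteristic. For $(c_1,\dots,c_{t-1})\in\mathbb{Z}^{t-1}$ with $|c_i|\le 1$ for $1\le i\le t-1$ and $|c_i-c_j|\le 1$ for $1\le i<j\le t-1$, let $s(c_1,\dots,c_{t-1})$ denote the generalized $F$-signature of the conic divisorial ideal of $S(t)$ corresponding to $(c_1,\dots,c_{t-1})$. Then for all integers $u\ge 0$ and $v>0$ with $u+v=t-1$, $$s(\underbrace{0,\dots,0}_{u},\underbrace{1,\dots,1}_{v})=s(\underbrace{0,\dots,0}_{u},\underbrace{-1,\dots,-1}_{v})=\frac{1}{\binom{t}{v}(t+1)},$$ and the same values hold for any permutation of the coordinates of these vectors. Moreover $$s(0,\dots,0)=s(S(t))=\frac{2}{t+1},$$ where $s(S(t))$ is the $F$-signature of $S(t)$.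
   Context: Let $p>0$ be the characteristic of $\Bbbk$. The Segre product $S(t)$ is the $\Bbbk$-algebra generated by all monomials $z_1z_2\cdots z_t$ with $z_i\in\{x_i,y_i\}$; its dimension is $d=t+1$. It is identified with the following toric (Hibi) ring $R$: take $\mathbb{R}^{t+1}$ with coordinates $(X_0,X_1,\dots,X_t)$ and linear forms $\sigma_{i,0}=X_0-X_i$, $\sigma_{i,1}=X_i$ for $1\le i\le t$; then $R=\Bbbk[\{\mathbf{m}\in\mathbb{Z}^{t+1}:\sigma_{i,0}(\mathbf{m})\ge0,\ \sigma_{i,1}(\mathbf{m})\ge 0 \text{ for all } i\}]$. Divisorial ideals: for a family of integers $\mathbf{a}=(a_{i,j})_{1\le i\le t,\,j\in\{0,1\}}$, $T(\mathbf{a})$ is the $R$-module generated by all Laurent monomials with exponent vector $\mathbf{m}\in\mathbb{Z}^{t+1}$ such that $\sigma_{i,j}(\mathbf{m})\ge a_{i,j}$ for all $i,j$. It is a divisorial ideal, and is called conic if (up to isomorphism) $a_{i,j}=\lceil\sigma_{i,j}(\mathbf{x})\rceil$ for all $i,j$, for some $\mathbf{x}\in\mathbb{R}^{t+1}$. One has $\mathrm{Cl}(S(t))\cong\mathbb{Z}^{t-1}$, where $(c_1,\dots,c_{t-1})$ corresponds to the divisorial ideal $T(\mathbf{a})$ with $a_{i,0}=c_i$ for $1\le i\le t-1$ and all other $a_{i,j}=0$. The conic divisorial ideals correspond one-to-one to the points $(c_1,\dots,c_{t-1})\in\mathbb{Z}^{t-1}$ satisfying $|c_i|\le1$ for all $i$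 and $|c_i-c_j|\le 1$ for all $i<j$; the point $(0,\dots,0)$ corresponds to the ring itself. Generalized $F$-signature: for every $e\in\mathbb{N}$ the $R$-module $R^{1/p^e}$ is a finite direct sum of conic divisorial ideals; passing to the completion at the irrelevant maximal ideal, where the Krull-Schmidt property holds, the multiplicities are well defined. If $c_e(M)$ denotes the multiplicity of the conic divisorial ideal $M$ in $R^{1/p^e}$, the generalized $F$-signature of $M$ is $s(M,R)=\lim_{e\to\infty}c_e(M)/p^{ed}$ with $d=\dim R$; the $F$-signature of $R$ is $s(R)=s(R,R)$. *)

(* Defs.v *)
From HB Require Import structures.
From mathcomp Require Import all_boot all_order all_algebra.
From mathcomp Require Import all_classical all_reals all_analysis.
(* The notations of mpoly clash with those of MathComp-Analysis. *)
From mathcomp Require Import -(notations) mpoly.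

Set Implicit Arguments.
Unset Strict Implicit.
Unset Printing Implicit Defensive.

Import Order.TTheory GRing.Theory Num.Theory.
Import numFieldNormedType.Exports.

Local Open Scope classical_set_scope.
Local Open Scope ring_scope.

Definition mod_iso (A : nzRingType) (M N : lmodType A) : Prop :=
  exists f : {linear M -> N}, bijective f.

(* N is isomorphic to the direct sum of the modules M i: maps out of a finite
   direct sum are families of maps out of the summands. *)
Definition iso_direct_sum (A : nzRingType) (N : lmodType A) (n : nat)
    (M : 'I_n -> lmodType A) : Prop :=
  exists f : forall i, {linear M i -> N},
    bijective (fun x : (forall i, M i) => \sum_(i < n) f i (x i)).

Inductive submod_generated (A : nzRingType) (V : lmodType A) (G : set V) :
    V -> Prop :=
| SubmodGen x of G x : submod_generated G x
| Submod0 : submod_generated G 0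
| SubmodD x y of submod_generated G x & submod_generated G y :
    submod_generated G (x + y)
| SubmodZ r x of submod_generated G x : submod_generated G (r *: x).

(* The A-module A^(1/p^e) of p^e-th roots of elements of A. The root of x is
   represented by x itself; since x^(1/q) + y^(1/q) = (x + y)^(1/q) and
   r x^(1/q) = (r^q x)^(1/q) for q = p^e, the addition is that of A and r acts
   as the multiplication by r^q. *)
Definition frob_root (A : comNzRingType) (p : nat) (charA : p \in [pchar A])
  (e : nat) : Type := A.

Section FrobRoot.
Variables (A : comNzRingType) (p : nat) (charA : p \in [pchar A]) (e : nat).

HB.instance Definition _ := GRing.Zmodule.copy (frob_root charA e) A.

Definition frob_root_scale (r : A) (x : frob_root charA e) : frob_root charA e :=
  r ^+ (p ^ e)%N * (x : A).

Fact frob_root_scaleA r s x :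
  frob_root_scale r (frob_root_scale s x) = frob_root_scale (r * s) x.
Proof. by rewrite /frob_root_scale exprMn mulrA. Qed.

Fact frob_root_scale1 : left_id 1 frob_root_scale.
Proof. by move=> x; rewrite /frob_root_scale expr1n mul1r. Qed.

Fact frob_root_scaleDr : right_distributive frob_root_scale +%R.
Proof. by move=> r x y; rewrite /frob_root_scale mulrDr. Qed.

Fact frob_root_scaleDl x : {morph frob_root_scale^~ x : r s / r + s}.
Proof.
have expD r s : (r + s) ^+ (p ^ e)%N = r ^+ (p ^ e)%N + s ^+ (p ^ e)%N :> A.
  elim: e => [|n IHn]; first by rewrite expn0 !expr1.
  rewrite expnS mulnC !exprM IHn.
  by have := pFrobenius_autD_comm charA (mulrC (r ^+ (p ^ n)%N) (s ^+ (p ^ n)%N)).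
by move=> r s; rewrite /frob_root_scale expD mulrDl.
Qed.

HB.instance Definition _ := GRing.Zmodule_isLmodule.Build A (frob_root charA e)
  frob_root_scaleA frob_root_scale1 frob_root_scaleDr frob_root_scaleDl.
End FrobRoot.

Section Segre.
Variables (k : fieldType) (t : nat).

Local Notation poly2t := (mpoly (t + t) k).

Definition xvar (i : 'I_t) : poly2t := mpolyX k (mnm1 (lshift t i)).
Definition yvar (i : 'I_t) : poly2t := mpolyX k (mnm1 (rshift t i)).

(* The Segre product S(t), inside k[x_1, ..., x_t, y_1, ..., y_t]: the k-algebra
   generated by the monomials z_1 ... z_t, z_i in {x_i, y_i}. *)
Inductive segre_elt : poly2t -> Prop :=
| SegreC (a : k) : segre_elt (mpolyC (t + t) a)
| SegreGen (z : 'I_t -> bool) :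
    segre_elt (\prod_(i < t) if z i then xvar i else yvar i)
| SegreD f g of segre_elt f & segre_elt g : segre_elt (f + g)
| SegreM f g of segre_elt f & segre_elt g : segre_elt (f * g).

Definition segre_pred : {pred poly2t} := fun f => `[< segre_elt f >].

Fact segre_subring_closed : subring_closed segre_pred.
Proof.
split=> [|f g /asboolP Sf /asboolP Sg|f g /asboolP Sf /asboolP Sg].
- by apply/asboolP; rewrite -mpolyC1; apply: SegreC.
- apply/asboolP; rewrite -mulN1r -mpolyC1 -mpolyCN.
  by apply: SegreD => //; apply: SegreM => //; apply: SegreC.
- by apply/asboolP; apply: SegreM.
Qed.

HB.instance Definition _ :=
  GRing.isSubringClosed.Build poly2t segre_pred segre_subring_closed.

Record segre := Segre { segre_val : poly2t; _ : segre_val \in segre_pred }.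

HB.instance Definition _ := [isSub for segre_val].
HB.instance Definition _ := [Choice of segre by <:].
HB.instance Definition _ := [SubChoice_isSubComNzRing of segre by <:].

Lemma segre_pchar (p : nat) : p \in [pchar k] -> p \in [pchar segre].
Proof.
rewrite !inE => /andP[-> /eqP pk0]; apply/eqP; apply: val_inj.
by rewrite rmorph_nat rmorph0 -mpolyC_nat pk0 mpolyC0.
Qed.

(* sigma m i false = X_0 - X_i and sigma m i true = X_i; the linear forms are
   used both on Z^(t+1) and on R^(t+1). *)
Definition sigma (Z : zmodType) (m : 'rV[Z]_t.+1) (i : 'I_t) (j : bool) : Z :=
  if j then m 0 (lift ord0 i) else m 0 ord0 - m 0 (lift ord0 i).

(* The fraction field of k[x, y], as a module over S(t). *)
Definition ambient : Type := {fraction poly2t}.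

HB.instance Definition _ := GRing.Zmodule.copy ambient {fraction poly2t}.

Definition ambient_scale (r : segre) (x : ambient) : ambient :=
  tofrac (segre_val r) * (x : {fraction poly2t}).

Fact ambient_scaleA r s x :
  ambient_scale r (ambient_scale s x) = ambient_scale (r * s) x.
Proof. by rewrite /ambient_scale mulrA -tofracM. Qed.

Fact ambient_scale1 : left_id 1 ambient_scale.
Proof. by move=> x; rewrite /ambient_scale tofrac1 mul1r. Qed.

Fact ambient_scaleDr : right_distributive ambient_scale +%R.
Proof. by move=> r x y; rewrite /ambient_scale mulrDr. Qed.

Fact ambient_scaleDl x : {morph ambient_scale^~ x : r s / r + s}.
Proof. by move=> r s; rewrite /ambient_scale tofracD mulrDl. Qed.

HB.instance Definition _ := GRing.Zmodule_isLmodule.Build segre ambient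
  ambient_scaleA ambient_scale1 ambient_scaleDr ambient_scaleDl.

(* The Laurent monomial with exponent vector m in Z^(t+1). Under the
   identification of S(t) with the toric ring, X_i is the exponent of x_i and
   X_0 the common degree in the pairs (x_i, y_i), so that the exponents of x_i
   and y_i are sigma_(i,1)(m) and sigma_(i,0)(m). *)
Definition laurent (m : 'rV[int]_t.+1) : ambient :=
  \prod_(i < t) (tofrac (xvar i) ^ sigma m i true
                 * tofrac (yvar i) ^ sigma m i false).

(* T(a), as the submodule generated by the monomials with sigma_(i,j) >= a_(i,j). *)
Definition divisorial_pred (a : 'I_t -> bool -> int) : {pred ambient} :=
  fun x => `[< submod_generated
                 [set laurent m | m in [set m | forall i j, a i j <= sigma m i j]]
                 x >].

Fact divisorial_submod_closed a : submod_closed (divisorial_pred a).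
Proof.
split=> [|r x y /asboolP Tx /asboolP Ty]; apply/asboolP; first exact: Submod0.
by apply: SubmodD => //; apply: SubmodZ.
Qed.

HB.instance Definition _ a := GRing.isSubmodClosed.Build segre ambient
  (divisorial_pred a) (divisorial_submod_closed a).

Record divisorial (a : 'I_t -> bool -> int) := Divisorial
  { divisorial_val : ambient; _ : divisorial_val \in divisorial_pred a }.

HB.instance Definition _ a := [isSub for @divisorial_val a].
HB.instance Definition _ a := [Choice of divisorial a by <:].
HB.instance Definition _ a := [SubChoice_isSubLmodule of divisorial a by <:].

(* The family a with a_(i,0) = c_i for i <= t - 1 and all other entries 0. *)
Definition class_family (c : 'I_t.-1 -> int) (i : 'I_t) (j : bool) : int :=
  if j then 0 else oapp c 0 (insub (val i)).

Definition class_ideal (c : 'I_t.-1 -> int) : lmodType segre :=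
  divisorial (class_family c).

Variable R : realType.

Definition conic (a : 'I_t -> bool -> int) : Prop :=
  exists x : 'rV[R]_t.+1, forall i j, a i j = Num.ceil (sigma x i j).

Variables (p : nat) (chark : p \in [pchar k]).

Definition conic_decomposition (e n : nat) (a : 'I_n -> 'I_t -> bool -> int) :
    Prop :=
  (forall l, conic (a l)) /\
  iso_direct_sum (frob_root (segre_pchar chark) e)
                 (fun l => divisorial (a l) : lmodType segre).

Definition summand_count (n : nat) (a : 'I_n -> 'I_t -> bool -> int)
    (M : lmodType segre) : nat :=
  #|[set l : 'I_n | `[< mod_iso (divisorial (a l)) M >]]%SET|.

(* c is the multiplicity of M in S(t)^(1/p^e): such a decomposition exists, and
   the number of summands isomorphic to M does not depend on it. *)
Definition is_multiplicity (M : lmodType segre) (e c : nat) : Prop :=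
  (exists n (a : 'I_n -> 'I_t -> bool -> int),
      conic_decomposition e a /\ summand_count a M = c) /\
  (forall n (a : 'I_n -> 'I_t -> bool -> int),
      conic_decomposition e a -> summand_count a M = c).

(* s(M, S(t)) = s, where dim S(t) = t + 1. *)
Definition is_gen_Fsignature (M : lmodType segre) (s : R) : Prop :=
  exists c : nat -> nat,
    (forall e, is_multiplicity M e (c e)) /\
    ((c e)%:R / (p%:R ^+ (e * t.+1)%N) : R) @[e --> \oo] --> s.

Definition is_Fsignature (s : R) : Prop :=
  is_gen_Fsignature (segre^o : lmodType segre) s.

End Segre.

(* The vector (0, ..., 0, d, ..., d) of length n with u zeros. *)
Definition block_vector (n u : nat) (d : int) (i : 'I_n) : int :=
  if (i < u)%N then 0 else d.

(* Main.v *)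
Require Import Defs.
From HB Require Import structures.
From mathcomp Require Import all_boot all_order all_algebra all_fingroup.
From mathcomp Require Import all_classical all_reals all_analysis.
From mathcomp Require Import -(notations) mpoly.
From mathcomp Require Import zify ring lra.

(* Give a monomial of k[x, y] the multidegree (d_1, ..., d_t), where d_i is its
   degree in (x_i, y_i). Then S(t) is spanned by the monomials whose d_i all
   agree, and T(a) is isomorphic to the span of those for which
   d_i + a_(i,0) + a_(i,1) does not depend on i: it only depends on the weight
   w_i = a_(i,0) + a_(i,1) modulo constant vectors.

   A homomorphism between two such modules is the multiplication by a
   polynomial, so taking the coefficient of a fixed monomial m in the image of m
   is multiplicative on compositions, and vanishes on those that go through a
   module of another weight class. Hence isomorphic direct sums yield mutually
   inverse matrices over k indexed by the summands of a given class, and the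
   multiplicities are well defined without completing.

   Dividing exponents by q = p^e, S(t)^(1/q) is the direct sum, over the
   residues (D, r_1, ..., r_t) in [0, q)^(t+1), of the modules of weights
   w_i = [D < r_i]; the summand of index (D, r) maps h to
   x^r y^((D - r) mod q) h^q, which is onto because k is perfect. A weight vector
   with a ones and b = t - a zeros thus occurs
   \sum_(D < q) (q - 1 - D)^a (D + 1)^b times; this is asymptotic to
   q^(t+1) a! b! / (t+1)!. Only the two constant vectors are identified. *)

Set Implicit Arguments.
Unset Strict Implicit.
Unset Printing Implicit Defensive.

Import Order.TTheory GRing.Theory Num.Theory.
Import numFieldNormedType.Exports.
Local Open Scope ring_scope.

(** * The grading by weights *)

Section Grading.
Variables (k : fieldType) (t : nat).
Local Notation P := (mpoly (t + t) k).
Local Notation mono := (multinom (t + t)).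
Local Notation R := (segre k t).
Implicit Types (m n : mono) (f g : P) (w : 'I_t -> int).

Definition pairdeg m (i : 'I_t) : nat := (m (lshift t i) + m (rshift t i))%N.

Definition balanced w m : Prop :=
  forall i j, (pairdeg m i)%:Z + w i = (pairdeg m j)%:Z + w j.

Definition graded w f : Prop := forall m, m \in msupp f -> balanced w m.

Definition mono_of (a b : 'I_t -> nat) : mono :=
  Multinom [tuple match fintype.split i with inl j => a j | inr j => b j end | i < t + t].

Lemma mono_ofl a b i : mono_of a b (lshift t i) = a i.
Proof. by rewrite /mono_of /fun_of_multinom tnth_mktuple (unsplitK (inl i)). Qed.

Lemma mono_ofr a b i : mono_of a b (rshift t i) = b i.
Proof. by rewrite /mono_of /fun_of_multinom tnth_mktuple (unsplitK (inr i)). Qed.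

Lemma mono_ext m n : (forall i, m (lshift t i) = n (lshift t i)) ->
  (forall i, m (rshift t i) = n (rshift t i)) -> m = n.
Proof.
move=> eql eqr; apply/mnmP => j.
by case: (splitP j) => i /esym ji; [have -> : j = lshift t i by exact: val_inj
  | have -> : j = rshift t i by exact: val_inj].
Qed.

Lemma pairdegD m n i : pairdeg (mnm_add m n) i = (pairdeg m i + pairdeg n i)%N.
Proof. by rewrite /pairdeg !mnmDE addnACA. Qed.

Lemma pairdeg_of a b i : pairdeg (mono_of a b) i = (a i + b i)%N.
Proof. by rewrite /pairdeg mono_ofl mono_ofr. Qed.

Lemma balancedD w w' m n : balanced w m -> balanced w' n ->
  balanced (fun i => w i + w' i) (mnm_add m n).
Proof. by move=> bm bn i j; have := bm i j; have := bn i j; rewrite !pairdegD; lia. Qed.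

Lemma balanced_eq w w' m : balanced w m ->
  (forall i j, w i - w' i = w j - w' j) -> balanced w' m.
Proof. by move=> bm ww i j; have := bm i j; have := ww i j; lia. Qed.

Lemma graded_eq w w' f : graded w f ->
  (forall i j, w i - w' i = w j - w' j) -> graded w' f.
Proof. by move=> gf ww m /gf bm; exact: balanced_eq bm ww. Qed.

Lemma gradedX w m : balanced w m -> graded w (mpolyX k m).
Proof. by move=> bm n; rewrite msuppX inE => /eqP ->. Qed.

Lemma graded0 w : graded w 0.
Proof. by move=> m; rewrite mcoeff_msupp mcoeff0 eqxx. Qed.

Lemma gradedD w f g : graded w f -> graded w g -> graded w (f + g).
Proof.
by move=> gf gg m /msuppD_le; rewrite mem_cat => /orP[/gf|/gg].
Qed.

Lemma gradedZ w c f : graded w f -> graded w (c *: f).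
Proof. by move=> gf m /msuppZ_le /gf. Qed.

Lemma gradedM w w' f g : graded w f -> graded w' g ->
  graded (fun i => w i + w' i) (f * g).
Proof.
move=> gf gg m /msuppM_le /allpairsP[[m1 m2] /= [/gf b1 /gg b2 ->]].
exact: balancedD.
Qed.

Lemma gradedXn w f (n : nat) : graded w f -> graded (fun i => n%:Z * w i) (f ^+ n).
Proof.
move=> gf; elim: n => [|n IH].
  rewrite expr0 -mpolyX0; apply: gradedX => i j.
  by rewrite /pairdeg !mnm0E; lia.
rewrite exprS; apply: graded_eq (gradedM gf IH) _ => i j; lia.
Qed.

Lemma balanced0_deg m : balanced (fun=> 0) m ->
  exists D, forall i, pairdeg m i = D.
Proof.
move=> bm; case: (pickP 'I_t) => [i _|no]; last first.
  by exists 0%N => i; have := no i.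
by exists (pairdeg m i) => j; have := bm i j; lia.
Qed.

Lemma segre_mono_gen (z : 'I_t -> bool) :
  \prod_(i < t) (if z i then xvar k i else yvar k i)
  = mpolyX k (mono_of (fun i => z i) (fun i => ~~ z i)).
Proof.
rewrite mpolyXE_id big_split_ord /= -big_split /=; apply: eq_bigr => i _.
by rewrite mono_ofl mono_ofr /xvar /yvar; case: (z i); rewrite ?expr1 ?expr0 ?mulr1 ?mul1r.
Qed.

(** Induction on the common degree of the pairs. Each step divides out one generator, which takes
    [x_i] where it occurs in the monomial and [y_i] elsewhere. *)
Lemma segre_elt_mono m : balanced (fun=> 0) m -> segre_elt (mpolyX k m).
Proof.
move=> /balanced0_deg [D]; elim: D m => [|D IH] m degm.
  have -> : m = mnm0.
    by apply: mono_ext => i; have := degm i; rewrite /pairdeg mnm0E; lia.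
  by rewrite mpolyX0 -mpolyC1; exact: SegreC.
pose z i := (0 < m (lshift t i))%N.
pose n := mono_of (fun i => m (lshift t i) - z i)%N
                  (fun i => m (rshift t i) - ~~ z i)%N.
have -> : m = mnm_add (mono_of (fun i => z i) (fun i => ~~ z i)) n.
  by apply: mono_ext => i; have := degm i;
    rewrite /pairdeg /n /z mnmDE ?mono_ofl ?mono_ofr; lia.
rewrite mpolyXD; apply: SegreM.
  by rewrite -segre_mono_gen; exact: SegreGen.
by apply: IH => i; have := degm i; rewrite /n /z pairdeg_of /pairdeg; lia.
Qed.

Lemma segre_eltE f : segre_elt f <-> graded (fun=> 0) f.
Proof.
split=> [|gf].
  elim=> {f} [a|z|f g _ gf _ gg|f g _ gf _ gg].
  - rewrite -[mpolyC _ a]mulr1 mul_mpolyC -mpolyX0; apply: gradedZ; apply: gradedX.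
    by move=> i j; rewrite /pairdeg !mnm0E.
  - rewrite segre_mono_gen; apply: gradedX => i j; rewrite !pairdeg_of; lia.
  - exact: gradedD.
  - by apply: graded_eq (gradedM gf gg) _.
rewrite (mpolyE f) big_seq; elim/big_ind: _ => [|g h|m /gf bm].
- by rewrite -mpolyC0; exact: SegreC.
- exact: SegreD.
- by rewrite -mul_mpolyC; apply: SegreM (SegreC _ _) (segre_elt_mono bm).
Qed.

Lemma segre_val_graded (r : R) : graded (fun=> 0) (segre_val r).
Proof. by case: r => f /= /asboolP /segre_eltE. Qed.

Lemma segre_of f : graded (fun=> 0) f -> exists r : R, segre_val r = f.
Proof.
move=> /segre_eltE sf; have sf' : f \in @segre_pred k t by exact/asboolP.
by exists (Segre sf').
Qed.

Lemma segre_valM (r s : R) : segre_val (r * s) = segre_val r * segre_val s.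
Proof. by []. Qed.

Lemma segre_valD (r s : R) : segre_val (r + s) = segre_val r + segre_val s.
Proof. by []. Qed.

End Grading.

(** * Homomorphisms and uniqueness of multiplicities *)

Lemma linear_pack (A : nzRingType) (U V : lmodType A) (f : U -> V) :
  linear f -> exists g : {linear U -> V}, g =1 f.
Proof.
move=> lf; pose g : {linear U -> V} :=
  HB.pack_for {linear U -> V} f (GRing.isLinear.Build A U V *:%R f lf).
by exists g.
Qed.

Lemma bijective_of (T U : Type) (f : T -> U) :
  injective f -> (forall y, exists x, f x = y) -> bijective f.
Proof.
move=> injf /boolp.choice [g fg]; exists g => // x; exact: injf.
Qed.

(** The projections are the components of the inverse bijection, which inherits linearity from the
    maps [f i]. *)
Lemma iso_direct_sum_proj (A : nzRingType) (N : lmodType A) (n : nat)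
    (M : 'I_n -> lmodType A) : iso_direct_sum N M ->
  exists (f : forall i, {linear M i -> N}) (pr : forall i, {linear N -> M i}),
    [/\ forall i x, pr i (f i x) = x, forall i j x, i != j -> pr i (f j x) = 0
      & forall y, \sum_i f i (pr i y) = y].
Proof.
move=> [f [g fg gf]].
have lg i : linear (fun y => g y i).
  move=> a x y; pose z j := a *: g x j + g y j.
  suff -> : a *: x + y = \sum_i f i (z i) by rewrite fg.
  rewrite -{1}(gf x) -{1}(gf y) scaler_sumr -big_split /=.
  by apply: eq_bigr => j _; rewrite linearP.
pose pr i := projT1 (cid (linear_pack (lg i))).
have prE i y : pr i y = g y i by exact: (projT2 (cid (linear_pack (lg i)))).
(* An element of one summand is a family that vanishes at all other indices; the inverse can then be
   evaluated on it. *)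
have fE j x : f j x = \sum_i f i (dfwith (fun i => 0 : M i) j x i).
  rewrite (bigD1 j) //= dfwithin big1 ?addr0 // => i ij.
  by rewrite dfwithout 1?eq_sym // linear0.
exists f, pr; split=> [i x|i j x ij|y].
- by rewrite prE fE fg dfwithin.
- by rewrite prE fE fg dfwithout // eq_sym.
- by rewrite -[RHS]gf; apply: eq_bigr => i _; rewrite prE.
Qed.

(** * Homomorphisms between modules of graded polynomials *)

Section Realizes.
Variables (k : fieldType) (t : nat).
Local Notation P := (mpoly (t + t) k).
Local Notation mono := (multinom (t + t)).
Local Notation R := (segre k t).
Implicit Types (m n : mono) (w : 'I_t -> int) (M : lmodType R).

(** A model of [M] as the module of polynomials of weight [w]. It treats divisorial ideals and the
    ring itself alike, and computations take place among polynomials. *)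
Definition realizes w M (phi : M -> P) : Prop :=
  [/\ {morph phi : x y / x + y},
      forall r x, phi (r *: x) = segre_val r * phi x,
      injective phi
    & forall f, (exists x, phi x = f) <-> graded w f].

Lemma realizes_sum w M (phi : M -> P) : realizes w phi ->
  forall (I : Type) (r : seq I) (Q : pred I) (F : I -> M),
  phi (\sum_(i <- r | Q i) F i) = \sum_(i <- r | Q i) phi (F i).
Proof.
move=> [phiD _ _ _] I r Q F; apply: (big_morph phi phiD).
by apply: (addrI (phi 0)); rewrite -phiD !addr0.
Qed.

(** Take for [s] the [N]-th power of the product of all variables, [N] being the total degree of
    [m]. Then [m] divides [s m'], and the quotient [r] has weight 0 because [m] and [m'] have the
    same weight. *)
Lemma balanced_common_multiple w m m' : balanced w m -> balanced w m' ->
  exists r s : mono, [/\ balanced (fun=> 0) r, balanced (fun=> 0) s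
                      & mnm_add r m = mnm_add s m'].
Proof.
move=> bm bm'; pose N := mdeg m.
have leN j : (m j <= N)%N by rewrite /N mdegE (bigD1 j) //= leq_addr.
exists (mono_of (fun i => N + m' (lshift t i) - m (lshift t i))%N
                (fun i => N + m' (rshift t i) - m (rshift t i))%N).
exists (mono_of (fun _ => N) (fun _ => N)); split.
- move=> i j; have := bm i j; have := bm' i j; rewrite !pairdeg_of /pairdeg.
  have := leN (lshift t i); have := leN (rshift t i).
  have := leN (lshift t j); have := leN (rshift t j); lia.
- by move=> i j; rewrite !pairdeg_of.
- by apply: mono_ext => i; rewrite !mnmDE ?mono_ofl ?mono_ofr;
  [have := leN (lshift t i) | have := leN (rshift t i)]; lia.
Qed.

(* In fact h is the multiplication by a polynomial: compare h on x^m with h on a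
   monomial that does not involve the variable z. *)
Lemma hom_support w w' M M' (phi : M -> P) (phi' : M' -> P)
    (h : {linear M -> M'}) m n x :
  realizes w phi -> realizes w' phi' -> phi x = mpolyX k m ->
  n \in msupp (phi' (h x)) -> forall z, (m z <= n z)%N.
Proof.
move=> [_ phiZ phiI phiP] [_ phi'Z _ _] phix nsupp z.
have bm : balanced w m.
  have /phiP gm : exists x, phi x = mpolyX k m by exists x.
  by apply: gm; rewrite msuppX inE.
(* Within each pair all the degree is moved to the variable on the side opposite to [z]; pair
   degrees, hence balancedness, are preserved. *)
have [m' [bm' m'z]] : exists m', balanced w m' /\ m' z = 0%N.
  case: (splitP z) => i zi.
    have -> : z = lshift t i by exact: val_inj.
    exists (mono_of (fun=> 0%N) (pairdeg m)); rewrite mono_ofl; split=> //.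
    by move=> i1 i2; rewrite !pairdeg_of !add0n; exact: bm.
  have -> : z = rshift t i by exact: val_inj.
  exists (mono_of (pairdeg m) (fun=> 0%N)); rewrite mono_ofr; split=> //.
  by move=> i1 i2; rewrite !pairdeg_of !addn0; exact: bm.
have [r [s [br bs rs]]] := balanced_common_multiple bm bm'.
have [x' phix'] : exists x', phi x' = mpolyX k m'.
  by apply/phiP; exact: gradedX.
have [a aE] := segre_of (gradedX (k := k) br); have [b bE] := segre_of (gradedX (k := k) bs).
have ax : a *: x = b *: x'.
  by apply: phiI; rewrite !phiZ aE bE phix phix' -!mpolyXD rs.
(* From [r x = s x'] the monomial [r n] occurs in [s h(x')], so [s] divides [r n]. As [r m = s m']
   and [m'] omits [z], the exponents of [z] in [s] and [r m] agree, which bounds that of [m] by that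
   of [n]. *)
have : mnm_add r n \in msupp (segre_val a * phi' (h x)).
  by rewrite aE mulrC mcoeff_msupp mcoeffMX -mcoeff_msupp.
rewrite -phi'Z -linearZZ ax linearZZ phi'Z bE => /msuppM_le /allpairsP.
move=> [[n1 n2] /= []]; rewrite msuppX inE => /eqP -> _ rn.
have := congr1 (fun m : mono => m z) rn; have := congr1 (fun m : mono => m z) rs.
rewrite /= !mnmDE m'z; lia.
Qed.

(** Expand [h x] into monomials [n]. By [hom_support], [m] divides every such [n], and [n] divides
    every monomial of the image of [n] under [g]. So only [n = m] contributes to the coefficient of
    [m], and this term is absent when [m] does not have weight [w']. *)
Lemma hom_comp_coeff w w' w'' M M' M'' (phi : M -> P) (phi' : M' -> P)
    (phi'' : M'' -> P) (h : {linear M -> M'}) (g : {linear M' -> M''}) m x :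
  realizes w phi -> realizes w' phi' -> realizes w'' phi'' ->
  phi x = mpolyX k m ->
  (forall y, phi' y = mpolyX k m -> mcoeff m (phi'' (g (h x))) =
     mcoeff m (phi'' (g y)) * mcoeff m (phi' (h x))) /\
  (~ balanced w' m -> mcoeff m (phi'' (g (h x))) = 0).
Proof.
move=> rM rM' rM'' phix; have [_ phi'Z phi'I phi'P] := rM'.
have [phi''D phi''Z _ _] := rM''.
have ghx n0 : n0 \in msupp (phi' (h x)) -> balanced w' n0.
  by have /phi'P gn : exists y, phi' y = phi' (h x) by [exists (h x)]; exact: gn.
(* [y n] represents the monomial [n] in [M']; outside the support its value is irrelevant and is set
   to 0. *)
have [y yE] : {y : mono -> M' & forall n,
    n \in msupp (phi' (h x)) -> phi' (y n) = mpolyX k n}.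
  apply: (boolp.choice (P := fun n yn => n \in msupp (phi' (h x)) -> phi' yn = mpolyX k n)).
  move=> n; case: (boolP (n \in _)) => [nin|_]; last by exists 0.
  by have [yn] : exists yn, phi' yn = mpolyX k n
    by [apply/phi'P; apply: gradedX; exact: ghx]; exists yn.
have [c cE] : {c : k -> R & forall a, segre_val (c a) = mpolyC _ a}.
  apply: (boolp.choice (P := fun a r => segre_val r = mpolyC _ a)) => a.
  by apply: segre_of; apply/segre_eltE; exact: SegreC.
have hxE : h x = \sum_(n <- msupp (phi' (h x))) c (mcoeff n (phi' (h x))) *: y n.
  apply: phi'I; rewrite (realizes_sum rM') {1}(mpolyE (phi' (h x))).
  rewrite big_seq [RHS]big_seq; apply: eq_bigr => n nin.
  by rewrite phi'Z cE mul_mpolyC yE.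
have cghx : mcoeff m (phi'' (g (h x))) =
    \sum_(n <- msupp (phi' (h x)) | n == m)
      mcoeff n (phi' (h x)) * mcoeff m (phi'' (g (y n))).
  rewrite {1}hxE linear_sum (realizes_sum rM'') raddf_sum /= [RHS]big_mkcond /=.
  rewrite big_seq [RHS]big_seq; apply: eq_bigr => n nin.
  rewrite linearZ /= phi''Z cE mul_mpolyC mcoeffZ; case: eqP => // nm.
  suff -> : mcoeff m (phi'' (g (y n))) = 0 by rewrite mulr0.
  apply/eqP; rewrite mcoeff_eq0; apply/negP => min; case: nm.
  have mn := hom_support rM rM' phix nin.
  have nm := hom_support rM' rM'' (yE _ nin) min.
  by apply/mnmP => z; apply/eqP; rewrite eqn_leq mn nm.
have eqm n : n \in msupp (phi' (h x)) -> n == m -> m \in msupp (phi' (h x)).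
  by move=> ? /eqP <-.
split=> [z zE|nb]; last first.
  rewrite cghx big_seq_cond big1 // => n /andP[nin /eqP nm].
  by case: nb; rewrite -nm; exact: ghx.
rewrite cghx; case: (boolP (m \in msupp (phi' (h x)))) => min.
  rewrite (big_rem m) //= eqxx big_seq_cond big1 => [|n /andP[]]; last first.
    by rewrite mem_rem_uniq ?msupp_uniq // inE => /andP[/negbTE ->].
  rewrite addr0 mulrC; congr (mcoeff m (phi'' (g _)) * _).
  by apply: phi'I; rewrite yE.
rewrite (memN_msupp_eq0 min) mulr0 big_seq_cond big1 // => n /andP[nin /eqP nm].
by rewrite -nm nin in min.
Qed.

(** A monomial in the [y_i] alone, with exponents [D - w_i] for a bound [D] of all the weights. *)
Lemma balanced_exists w : exists m, balanced w m.
Proof.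
pose D := \sum_i `|w i|.
have Dw i : w i <= D.
  by apply: le_trans (ler_norm _) _; rewrite /D (bigD1 i) //= lerDl sumr_ge0.
exists (mono_of (fun=> 0%N) (fun i => `|D - w i|%N)) => i j.
rewrite !pairdeg_of; have := Dw i; have := Dw j; lia.
Qed.

Lemma realizes_sec w M (phi : M -> P) : realizes w phi ->
  exists s : P -> M, forall f, graded w f -> phi (s f) = f.
Proof.
move=> [_ _ _ phiP].
suff [s sE] : {s : P -> M & forall f, graded w f -> phi (s f) = f} by exists s.
apply: (boolp.choice (P := fun f x => graded w f -> phi x = f)) => f.
have [/phiP [x xf]|nf] := pselect (graded w f); first by exists x.
by exists 0 => /nf.
Qed.

(** If [g] is inverse to [h], the coefficient of [m] in [g (h x) = x] is 1, so the composition
    cannot vanish and [m] has both weights. Conversely, equivalent weights define the same set of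
    polynomials, along which the modules are identified. *)
Lemma realizes_iso w w' M M' (phi : M -> P) (phi' : M' -> P) :
  realizes w phi -> realizes w' phi' ->
  mod_iso M M' <-> (forall i j, w i - w' i = w j - w' j).
Proof.
move=> rM rM'; have [phiD phiZ phiI phiP] := rM.
have [phi'D phi'Z phi'I phi'P] := rM'.
have [s sE] := realizes_sec rM; have [s' s'E] := realizes_sec rM'.
split=> [[h hbij]|ww].
  have [m bm] := balanced_exists w.
  case: hbij => g hg gh.
  have [g1 g1E] : exists g1 : {linear M' -> M}, g1 =1 g.
    by apply: linear_pack => a x y; apply: (can_inj hg); rewrite linearP !gh.
  have xE := sE _ (gradedX (k := k) bm).
  have [_] := hom_comp_coeff h g1 rM rM' rM xE.
  rewrite g1E hg xE mcoeffX eqxx => nb.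
  have [bm'|/nb /eqP] := pselect (balanced w' m); last by rewrite oner_eq0.
  by move=> i j; have := bm i j; have := bm' i j; lia.
have gw x : graded w' (phi x).
  by apply: graded_eq ww; apply/phiP; exists x.
have [h hE] : exists h : {linear M -> M'}, h =1 (fun x => s' (phi x)).
  apply: linear_pack => a x y; apply: phi'I.
  by rewrite phi'D phi'Z !s'E // phiD phiZ.
exists h; apply: bijective_of => [x y|y].
  by rewrite !hE => /(congr1 phi'); rewrite !s'E //; exact: phiI.
have gy : graded w (phi' y).
  apply: (graded_eq (w := w')) => [|i j]; last by have := ww i j; lia.
  by apply/phi'P; exists y.
by exists (s (phi' y)); rewrite hE; apply: phi'I; rewrite (s'E _ (gw _)) sE.
Qed.

(** The coefficients of [m] in the components of the change of decomposition form matrices [A] and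
    [B] with [A B = 1]. An identity matrix of size [#|S'|] that factors through size [#|S|] forces
    the inequality. *)
Lemma direct_sum_count_le (N : lmodType R)
    (n : nat) (M : 'I_n -> lmodType R) (w : 'I_n -> 'I_t -> int) (phi : forall i, M i -> P)
    (n' : nat) (M' : 'I_n' -> lmodType R) (w' : 'I_n' -> 'I_t -> int)
    (phi' : forall i, M' i -> P) m :
  (forall i, realizes (w i) (phi i)) -> (forall i, realizes (w' i) (phi' i)) ->
  iso_direct_sum N M -> iso_direct_sum N M' ->
  (#|[set i | `[< balanced (w' i) m >]]%SET|
   <= #|[set i | `[< balanced (w i) m >]]%SET|)%N.
Proof.
move=> rM rM' /iso_direct_sum_proj [f [pr [prf prf0 fpr]]].
move=> /iso_direct_sum_proj [f' [pr' [prf' prf0' fpr']]].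
have sec i := realizes_sec (rM i); have sec' i := realizes_sec (rM' i).
pose x i : M i := projT1 (cid (sec i)) (mpolyX k m).
pose x' i : M' i := projT1 (cid (sec' i)) (mpolyX k m).
have xE i : balanced (w i) m -> phi i (x i) = mpolyX k m.
  by move=> bm; apply: (projT2 (cid (sec i))); exact: gradedX.
have xE' i : balanced (w' i) m -> phi' i (x' i) = mpolyX k m.
  by move=> bm; apply: (projT2 (cid (sec' i))); exact: gradedX.
set S' := [set i | _]%SET; set S := [set i | _]%SET.
have inS (i : 'I_#|S|) : balanced (w (enum_val i)) m.
  by have := enum_valP i; rewrite inE => /asboolP.
have inS' (i : 'I_#|S'|) : balanced (w' (enum_val i)) m.
  by have := enum_valP i; rewrite inE => /asboolP.
pose A := \matrix_(i < #|S'|, j < #|S|)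
  mcoeff m (phi' (enum_val i) (pr' (enum_val i) (f (enum_val j) (x (enum_val j))))).
pose B := \matrix_(j < #|S|, i < #|S'|)
  mcoeff m (phi (enum_val j) (pr (enum_val j) (f' (enum_val i) (x' (enum_val i))))).
apply: (@mulmx1_min k _ _ A B); apply/matrixP => i1 i2; rewrite !mxE.
set i := enum_val i1; set j := enum_val i2.
pose F l := mcoeff m (phi' i (pr' i (f l (pr l (f' j (x' j)))))).
have FE (l : 'I_#|S|) : A i1 l * B l i2 = F (enum_val l).
  rewrite !mxE /F.
  have [h hE] : exists h : {linear M (enum_val l) -> M' i},
      h =1 (fun y => pr' i (f (enum_val l) y)).
    by apply: linear_pack => a y z; rewrite !linearP.
  have [g gE] : exists g : {linear M' j -> M (enum_val l)},
      g =1 (fun y => pr (enum_val l) (f' j y)).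
    by apply: linear_pack => a y z; rewrite !linearP.
  have [+ _] := hom_comp_coeff g h (rM' j) (rM (enum_val l)) (rM' i) (xE' _ (inS' i2)).
  by move=> /(_ _ (xE _ (inS l))); rewrite !gE !hE => ->.
have -> : \sum_l A i1 l * B l i2 = \sum_(l in S) F l.
  by rewrite [RHS]big_enum_val; apply: eq_bigr => l _; exact: FE.
(* Passing through a summand of another weight class contributes 0, so the sum may run over all
   summands, where the maps [f l] after [pr l] add up to the identity. *)
have -> : \sum_(l in S) F l = \sum_l F l.
  rewrite [RHS](bigID [in S]) /= [X in _ + X]big1 ?addr0 // => l.
  rewrite inE => /asboolPn nb; rewrite /F.
  have [h hE] : exists h : {linear M l -> M' i}, h =1 (fun y => pr' i (f l y)).
    by apply: linear_pack => a y z; rewrite !linearP.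
  have [g gE] : exists g : {linear M' j -> M l}, g =1 (fun y => pr l (f' j y)).
    by apply: linear_pack => a y z; rewrite !linearP.
  have [_ /(_ nb)] := hom_comp_coeff g h (rM' j) (rM l) (rM' i) (xE' _ (inS' i2)).
  by rewrite !gE !hE.
rewrite /F -raddf_sum -(realizes_sum (rM' i)) -linear_sum fpr.
have [ij|ij] := eqVneq i1 i2.
  by rewrite /i /j -ij prf' (xE' _ (inS' i1)) /= mcoeffX eqxx.
rewrite prf0' ?(inj_eq enum_val_inj) //.
have [_ phi'Z _ _] := rM' i.
by rewrite -(scale0r 0) phi'Z mul0r /= mcoeff0.
Qed.

End Realizes.

(** * Divisorial ideals *)

Section LaurentMonomials.
Variables (k : fieldType) (t : nat).
Local Notation P := (mpoly (t + t) k).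
Variables (K : fieldType) (iota : {rmorphism P -> K}).
Hypothesis iota_inj : injective iota.
Implicit Types (m : multinom (t + t)) (a b : 'I_t -> bool -> int).

(** The exponents are arbitrary here and need not have a common degree in the pairs: for a family
    [a] this is the corner of the cone that defines T(a), and may lie outside T(a). *)
Definition laurent_mono a : K :=
  \prod_(i < t) (iota (xvar k i) ^ a i true * iota (yvar k i) ^ a i false).

Lemma iota_mpolyX_neq0 m : iota (mpolyX k m) != 0.
Proof.
by rewrite -(rmorph0 iota) (inj_eq iota_inj) -msupp_eq0 msuppX.
Qed.

Lemma laurent_mono_neq0 a : laurent_mono a != 0.
Proof.
apply/prodf_neq0 => i _.
by apply: mulf_neq0; apply: expfz_neq0; exact: iota_mpolyX_neq0.
Qed.

Lemma laurent_monoD a b :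
  laurent_mono (fun i j => a i j + b i j) = laurent_mono a * laurent_mono b.
Proof.
rewrite /laurent_mono -big_split /=; apply: eq_bigr => i _.
by rewrite !expfzDr ?iota_mpolyX_neq0 // mulrACA.
Qed.

Lemma eq_laurent_mono a b : (forall i j, a i j = b i j) ->
  laurent_mono a = laurent_mono b.
Proof. by move=> ab; apply: eq_bigr => i _; rewrite !ab. Qed.

Lemma iota_mpolyX m : iota (mpolyX k m) =
  laurent_mono (fun i j => (if j then m (lshift t i) else m (rshift t i))%:Z).
Proof.
rewrite mpolyXE_id rmorph_prod big_split_ord /= -big_split /=.
by apply: eq_bigr => i _; rewrite !rmorphXn /=.
Qed.

Definition family_weight a (i : 'I_t) : int := a i true + a i false.

(** Divide by the corner of the cone. The exponents stay nonnegative, and since the two forms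
    [sigma] of index [i] add up to [X_0], the quotient has pair degrees [X_0 - w_i]. *)
Lemma sigma_graded a (x : 'rV[int]_t.+1) : (forall i j, a i j <= sigma x i j) ->
  exists m, balanced (family_weight a) m /\
            laurent_mono (sigma x) = laurent_mono a * iota (mpolyX k m).
Proof.
move=> ax.
exists (mono_of (fun i => `|sigma x i true - a i true|%N)
                (fun i => `|sigma x i false - a i false|%N)).
split=> [i j|].
  rewrite !pairdeg_of /family_weight.
  have := ax i true; have := ax i false; have := ax j true; have := ax j false.
  by rewrite /sigma; lia.
rewrite iota_mpolyX -laurent_monoD; apply: eq_laurent_mono => i j.
have := ax i j; by case: j; rewrite ?mono_ofl ?mono_ofr; lia.
Qed.

Lemma graded_sigma a m : balanced (family_weight a) m ->
  exists2 x : 'rV[int]_t.+1, (forall i j, a i j <= sigma x i j) &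
    laurent_mono a * iota (mpolyX k m) = laurent_mono (sigma x).
Proof.
move=> bm.
(* This common value becomes the coordinate [X_0]; it is 0 by default when there are no pairs. *)
have [D DE] : exists D : int, forall i, (pairdeg m i)%:Z + family_weight a i = D.
  case: (pickP 'I_t) => [i _|no]; last by exists 0 => i; have := no i.
  by exists ((pairdeg m i)%:Z + family_weight a i) => j; rewrite (bm j i).
pose x : 'rV[int]_t.+1 := \row_j
  if unlift ord0 j is Some i then a i true + (m (lshift t i))%:Z else D.
have xE i j : sigma x i j =
    a i j + (if j then m (lshift t i) else m (rshift t i))%:Z.
  rewrite /sigma !mxE liftK unlift_none; case: j => //.
  by have := DE i; rewrite /pairdeg /family_weight /=; lia.
exists x => [i j|]; first by rewrite xE lerDl.
by rewrite iota_mpolyX -laurent_monoD; apply: eq_laurent_mono => i j; rewrite xE.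
Qed.

(** A description of T(a) free of generators: the corner monomial times the polynomials of weight
    [family_weight a]. *)
Definition laurent_graded a (x : K) : Prop :=
  exists2 f, graded (family_weight a) f & x = laurent_mono a * iota f.

Lemma laurent_graded_sigma a (s : 'rV[int]_t.+1) :
  (forall i j, a i j <= sigma s i j) -> laurent_graded a (laurent_mono (sigma s)).
Proof.
by move=> /sigma_graded [m [bm ->]]; exists (mpolyX k m) => //; exact: gradedX.
Qed.

Lemma laurent_graded0 a : laurent_graded a 0.
Proof. by exists 0; [exact: graded0 | rewrite rmorph0 mulr0]. Qed.

Lemma laurent_gradedD a x y :
  laurent_graded a x -> laurent_graded a y -> laurent_graded a (x + y).
Proof.
move=> [f gf ->] [g gg ->].
by exists (f + g); [exact: gradedD | rewrite rmorphD mulrDr].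
Qed.

Lemma laurent_gradedM a h x : graded (fun=> 0) h ->
  laurent_graded a x -> laurent_graded a (iota h * x).
Proof.
move=> gh [f gf ->]; exists (h * f); last by rewrite rmorphM mulrCA.
apply: graded_eq (gradedM gh gf) _ => i j; lia.
Qed.

Lemma laurent_graded_ind a (Q : K -> Prop) : Q 0 ->
  (forall x y, Q x -> Q y -> Q (x + y)) ->
  (forall c (s : 'rV[int]_t.+1), (forall i j, a i j <= sigma s i j) ->
     Q (iota (mpolyC _ c) * laurent_mono (sigma s))) ->
  forall x, laurent_graded a x -> Q x.
Proof.
move=> Q0 QD QZ _ [f gf ->].
rewrite (mpolyE f) rmorph_sum mulr_sumr big_seq.
elim/big_ind: _ => // m /gf /graded_sigma [s sa ms].
by rewrite /= -mul_mpolyC rmorphM mulrCA ms; exact: QZ.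
Qed.

Lemma laurent_mono_mulI a : injective (fun f => laurent_mono a * iota f).
Proof. by move=> f g /(mulfI (laurent_mono_neq0 a)) /iota_inj. Qed.

End LaurentMonomials.

(** * Divisorial ideals in the fraction field as graded polynomials *)

Section Divisorial.
Variables (k : fieldType) (t : nat).
Local Notation P := (mpoly (t + t) k).
Local Notation F := {fraction mpoly (t + t) k}.
Local Notation R := (segre k t).
Local Notation frac := (@tofrac P : {rmorphism P -> F}).
Implicit Types (a : 'I_t -> bool -> int) (f g : P).

Lemma tofrac_inj : injective frac.
Proof. by move=> f g /eqP; rewrite tofrac_eq => /eqP. Qed.

Lemma divisorial_predE a (x : ambient k t) :
  x \in divisorial_pred a <-> laurent_graded frac a x.
Proof.
split=> [/asboolP|gx].
  elim=> {x} [_ [m am <-]||x y _ gx _ gy|r x _ gx].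
  - exact: (laurent_graded_sigma tofrac_inj am).
  - exact: (laurent_graded0 frac a).
  - exact: (laurent_gradedD gx gy).
  - change (laurent_graded frac a (frac (segre_val r) * (x : F))).
    exact: (laurent_gradedM (@segre_val_graded k t r) gx).
apply/asboolP; move: x gx; apply: (laurent_graded_ind tofrac_inj).
- exact: Submod0.
- by move=> x y; exact: (@SubmodD _ (ambient k t : lmodType R) _ x y).
- move=> c s sa.
  have [r rE] : exists r : R, segre_val r = mpolyC _ c.
    by apply: segre_of; apply/segre_eltE; exact: SegreC.
  rewrite -rE.
  apply: (@SubmodZ _ _ _ r (laurent k s : ambient k t)).
  by apply: SubmodGen; exists s.
Qed.

(** The map [phi] is the division by the corner monomial of the cone. *)
Lemma divisorial_realizes a :
  exists phi : divisorial k a -> P, realizes (family_weight a) phi.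
Proof.
pose L f : F := laurent_mono frac a * frac f.
have LD f g : L (f + g) = L f + L g.
  by rewrite /L rmorphD mulrDr.
have LM f g : L (f * g) = frac f * L g.
  by rewrite /L rmorphM mulrCA.
have L_inj : injective L by exact: (laurent_mono_mulI tofrac_inj).
have [phi phiE] : {phi : divisorial k a -> P & forall y,
    graded (family_weight a) (phi y) /\ L (phi y) = divisorial_val y}.
  apply: (boolp.choice (P := fun (y : divisorial k a) f =>
    graded (family_weight a) f /\ L f = divisorial_val y)).
  by case=> y yP; have [f gf yf] := (divisorial_predE a y).1 yP; exists f.
exists phi; split=> [x y|r x|x y xy|f].
- apply: L_inj; rewrite LD.
  have [_ ->] := phiE x; have [_ ->] := phiE y; by have [_ ->] := phiE (x + y).
- apply: L_inj; rewrite LM.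
  by have [_ ->] := phiE x; have [_ ->] := phiE (r *: x).
- apply: val_inj => /=.
  by have [_ <-] := phiE x; have [_ <-] := phiE y; rewrite xy.
- split=> [[x <-]|gf]; first by have [] := phiE x.
  have yP : L f \in @divisorial_pred k t a by apply/divisorial_predE; exists f.
  exists (Divisorial yP); apply: L_inj; by have [_ ->] := phiE (Divisorial yP).
Qed.

Lemma segre_realizes : realizes (fun=> 0) (@segre_val k t : (R^o : lmodType R) -> P).
Proof.
split=> // [x y|f]; first exact: val_inj.
by split=> [[x <-]|]; [exact: segre_val_graded | exact: segre_of].
Qed.

End Divisorial.

(** * Decomposition of the module of roots *)

Lemma pchar_exprD (A : comNzRingType) (p e : nat) : p \in [pchar A] ->
  forall x y : A, (x + y) ^+ (p ^ e) = x ^+ (p ^ e) + y ^+ (p ^ e).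
Proof.
move=> charA x y; apply: exprDn_pchar.
rewrite pnatX (eq_pnat _ (pcharf_eq charA)) pnat_id //.
by move: charA; rewrite inE => /andP[].
Qed.

Lemma pchar_expr_inj (F : fieldType) (p e : nat) : p \in [pchar F] ->
  injective (fun x : F => x ^+ (p ^ e)).
Proof.
move=> charF x y /= /eqP; rewrite -subr_eq0.
have q_gt0 : (0 < p ^ e)%N.
  by move: charF; rewrite inE expn_gt0 => /andP[/prime_gt0 ->].
suff -> : x ^+ (p ^ e) - y ^+ (p ^ e) = (x - y) ^+ (p ^ e).
  by rewrite expf_eq0 q_gt0 subr_eq0 => /eqP.
by rewrite -[x in LHS](subrK y) (pchar_exprD _ charF) addrK.
Qed.

Lemma closed_field_root (F : closedFieldType) (n : nat) (c : F) : (0 < n)%N ->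
  exists x, x ^+ n = c.
Proof.
move=> n_gt0; have /closed_rootP [x] : size ('X^n - c%:P) != 1%N.
  by rewrite size_XnsubC // eqSS -lt0n.
by rewrite rootE !hornerE subr_eq0 => /eqP <-; exists x; rewrite ?hornerXn.
Qed.

(** * Residues modulo [q] and Euclidean division of monomials *)

Section Residues.
Variables (t q : nat).
Local Notation mono := (multinom (t + t)).
Local Notation residue := ('I_q * {ffun 'I_t -> 'I_q})%type.
Implicit Types (j : residue) (m n : mono).

(** For [j = (D, r)] this is x^r y^((D - r) mod q); the conditional adds [q] exactly when the
    subtraction would be negative, which [residue_wrap] records. *)
Definition residue_mono j : mono :=
  mono_of (fun i => j.2 i)
          (fun i => if (j.2 i <= j.1)%N then j.1 - j.2 i else j.1 + q - j.2 i)%N.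

Definition residue_wrap j (i : 'I_t) : bool := (j.1 < j.2 i)%N.

Definition residue_family j (i : 'I_t) (b : bool) : int :=
  if b then 0 else (residue_wrap j i)%:Z.

Lemma residue_mono_lt j z : (residue_mono j z < q)%N.
Proof.
case: (splitP z) => i zi.
  by rewrite (_ : z = lshift t i) ?mono_ofl //; exact: val_inj.
rewrite (_ : z = rshift t i) ?mono_ofr; last exact: val_inj.
have := ltn_ord j.1; have := ltn_ord (j.2 i); case: ifP; lia.
Qed.

Lemma pairdeg_residue j i :
  pairdeg (residue_mono j) i = (j.1 + q * residue_wrap j i)%N.
Proof.
rewrite pairdeg_of /residue_wrap; have := ltn_ord (j.2 i).
by case: (leqP (j.2 i) j.1) => /=; lia.
Qed.

(** The exponents of the [x_i] give [r]; then [D] is read off the [y] exponent in one pair, which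
    exists because [t] is positive. *)
Lemma residue_mono_inj : (0 < t)%N -> injective residue_mono.
Proof.
move=> t_gt0 j j' jj'.
have r_eq i : j.2 i = j'.2 i.
  by apply: val_inj; have := congr1 (fun m : mono => m (lshift t i)) jj';
     rewrite /= !mono_ofl.
have := congr1 (fun m : mono => m (rshift t (Ordinal t_gt0))) jj'.
rewrite /= !mono_ofr r_eq => D_eq.
suff D_eq' : j.1 = j'.1.
  have : j.2 = j'.2 by apply/ffunP.
  by case: j j' D_eq' {jj' r_eq D_eq} => [D r] [D' r'] /= -> ->.
apply: val_inj => /=; move: D_eq; have := ltn_ord j.1; have := ltn_ord j'.1.
have := ltn_ord (j'.2 (Ordinal t_gt0)); case: ifP; case: ifP; lia.
Qed.

Lemma mono_division m n m' n' : (forall z, n z < q)%N -> (forall z, n' z < q)%N ->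
  mnm_add (mnm_muln m q) n = mnm_add (mnm_muln m' q) n' -> m = m' /\ n = n'.
Proof.
move=> nq n'q mn.
have mnz z : (m z * q + n z = m' z * q + n' z)%N.
  by have := congr1 (fun m : mono => m z) mn; rewrite /= !mnmDE !mulmnE.
have eqn z : n z = n' z.
  by have := congr1 (modn^~ q) (mnz z); rewrite /= !modnMDl !modn_small.
split; apply/mnmP => z //.
have := mnz z; rewrite eqn => /addIn /eqP.
by rewrite eqn_pmul2r ?(leq_ltn_trans _ (nq z)) // => /eqP.
Qed.

(** Take [D] and [r_i] to be the residues of the common degree and of the exponents of the [x_i];
    those of the [y_i] are then forced. *)
Lemma residue_division m : (0 < q)%N -> balanced (fun=> 0) m ->
  exists j n, balanced (fun i => (residue_wrap j i)%:Z) n /\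
              m = mnm_add (mnm_muln n q) (residue_mono j).
Proof.
move=> q_gt0 /balanced0_deg [D DE].
pose j : residue := (Ordinal (ltn_pmod D q_gt0),
  [ffun i => Ordinal (ltn_pmod (m (lshift t i)) q_gt0)]).
pose n := mono_of (fun i => m (lshift t i) %/ q)%N (fun i => m (rshift t i) %/ q)%N.
have mE : m = mnm_add (mnm_muln n q) (residue_mono j).
  apply: mono_ext => i; rewrite mnmDE mulmnE.
    by rewrite !mono_ofl ffunE /= -divn_eq.
  rewrite !mono_ofr ffunE /= [LHS](divn_eq _ q); congr (_ + _)%N.
  have := DE i; rewrite /pairdeg => <-; set b := m (rshift t i); set a := m (lshift t i).
  rewrite -(modnDm a b q); have := ltn_pmod a q_gt0; have := ltn_pmod b q_gt0.
  move: (a %% q)%N (b %% q)%N => c d dq cq.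
  (* The sum of the two residues carries exactly when the common degree has a smaller residue than
     the exponent of [x_i]. *)
  have [cdq|cdq] := ltnP (c + d) q.
    by rewrite (modn_small cdq) leq_addr addKn.
  have -> : ((c + d) %% q = c + d - q)%N.
    by rewrite -{1}(subnK cdq) modnDr modn_small //; lia.
  by case: ifP; lia.
exists j, n; split=> // i i'.
have wrapE l : (q * pairdeg n l + (j.1 + q * residue_wrap j l) = D)%N.
  rewrite -(DE l) -pairdeg_residue mE pairdegD; congr (_ + _)%N.
  by rewrite /pairdeg !mulmnE -mulnDl mulnC.
have : (q * (pairdeg n i + residue_wrap j i) =
        q * (pairdeg n i' + residue_wrap j i'))%N.
  by have := wrapE i; have := wrapE i'; rewrite !mulnDr; lia.
by move=> /eqP; rewrite eqn_pmul2l // => /eqP; lia.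
Qed.

Lemma residue_conic (R : realType) j : conic R (residue_family j).
Proof.
have q_gt0 : (0 < q)%N by case: j => D _; exact: leq_ltn_trans (ltn_ord D).
have q_gt0' : 0 < q%:R :> R by rewrite ltr0n.
(* At the point [-(D, r)/q] the form [X_i] takes a value in (-1, 0], with ceiling 0, and [X_0 - X_i]
   takes the value [(r_i - D)/q] in (-1, 1), with ceiling 1 exactly when [D < r_i]. *)
exists (\row_z - ((if unlift ord0 z is Some i then j.2 i else j.1)%:R / q%:R)).
move=> i b; apply/esym/ceil_def; rewrite /sigma !mxE unlift_none liftK /residue_family.
have [ri D] : (j.2 i < q)%N /\ (j.1 < q)%N by split; exact: ltn_ord.
have ri' : (j.2 i)%:R < q%:R :> R by rewrite ltr_nat.
have D' : (j.1 : nat)%:R < q%:R :> R by rewrite ltr_nat.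
case: b.
  rewrite sub0r mulrNz lterN2 mulr0z oppr_le0 divr_ge0 // andbT.
  by rewrite ltr_pdivrMr // mul1r.
have -> : - (j.1%:R / q%:R) - - ((j.2 i)%:R / q%:R) =
    ((j.2 i)%:R - j.1%:R) / q%:R :> R by rewrite opprK addrC mulrBl.
rewrite ltr_pdivlMr // ler_pdivrMr //.
rewrite /residue_wrap; case: (ltnP j.1 (j.2 i)) => /= Dr.
  have : (j.1 : nat)%:R < (j.2 i)%:R :> R by rewrite ltr_nat.
  have : 0 <= (j.1 : nat)%:R :> R by rewrite ler0n.
  by rewrite subrr mulr0z mul0r mulr1z mul1r; lra.
have : (j.2 i)%:R <= (j.1 : nat)%:R :> R by rewrite ler_nat.
have : 0 <= (j.2 i)%:R :> R by rewrite ler0n.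
by rewrite sub0r mulrNz mulr0z mul0r mulr1z mulN1r; lra.
Qed.

Lemma weight_residue_family j i : family_weight (residue_family j) i = (residue_wrap j i)%:Z.
Proof. by rewrite /family_weight add0r. Qed.

End Residues.

(** * The decomposition of the [q]-th roots indexed by residues *)

Section FrobeniusDecomposition.
Variables (k : closedFieldType) (t p e : nat) (chark : p \in [pchar k]).
Hypothesis t_gt0 : (0 < t)%N.
Local Notation P := (mpoly (t + t) k).
Local Notation mono := (multinom (t + t)).
Local Notation R := (segre k t).
Local Notation q := (p ^ e)%N.
Local Notation residue := ('I_q * {ffun 'I_t -> 'I_q})%type.
Implicit Types (m n : mono) (f g : P).

Lemma frob_q_gt0 : (0 < q)%N.
Proof.
by move: chark; rewrite inE expn_gt0 => /andP[/prime_gt0 ->].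
Qed.

Lemma pchar_mpoly : p \in [pchar P].
Proof.
move: chark; rewrite !inE => /andP[-> /eqP pk0].
by rewrite -mpolyC_nat pk0 mpolyC0 eqxx.
Qed.

Lemma mpoly_frobE f :
  f ^+ q = \sum_(m <- msupp f) (mcoeff m f) ^+ q *: mpolyX k (mnm_muln m q).
Proof.
rewrite {1}(mpolyE f) (big_morph _ (pchar_exprD e pchar_mpoly) (id1 := 0)).
  by apply: eq_bigr => m _; rewrite exprZn mpolyXn.
by rewrite expr0n gtn_eqF // frob_q_gt0.
Qed.

(** By uniqueness of Euclidean division, distinct residue monomials give disjoint supports, and
    within one residue each coefficient of [f] is recovered as its [q]-th power. *)
Lemma mcoeff_residue_frob f m n n' :
  (forall z, n z < q)%N -> (forall z, n' z < q)%N ->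
  mcoeff (mnm_add (mnm_muln m q) n') (mpolyX k n * f ^+ q)
  = (n == n')%:R * (mcoeff m f) ^+ q.
Proof.
move=> nq n'q; rewrite mpoly_frobE mulr_sumr raddf_sum /=.
transitivity (\sum_(l <- msupp f) if l == m then (n == n')%:R * (mcoeff l f) ^+ q else 0).
  apply: eq_bigr => l _; rewrite -scalerAr -mpolyXD mcoeffZ mcoeffX addmC.
  case: (eqVneq l m) => [->|lm]; first by rewrite eqm_add2l mulrC.
  case: eqP => [/(mono_division nq n'q) [lm']|_]; last by rewrite mulr0.
  by rewrite lm' eqxx in lm.
rewrite -big_mkcond /=; case: (boolP (m \in msupp f)) => mf.
  rewrite (big_rem m) //= eqxx big_seq_cond big1 ?addr0 // => l /andP[].
  by rewrite mem_rem_uniq ?msupp_uniq // inE => /andP[/negbTE ->].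
rewrite (memN_msupp_eq0 mf) expr0n gtn_eqF ?frob_q_gt0 // mulr0.
rewrite big_seq_cond big1 // => l /andP[lf /eqP lm].
by rewrite -lm lf in mf.
Qed.

Lemma residue_frob_graded (j : residue) f :
  graded (fun i => (residue_wrap j i)%:Z) f ->
  graded (fun=> 0) (mpolyX k (residue_mono j) * f ^+ q).
Proof.
move=> gf; have gj : graded (fun i => - (q%:Z * (residue_wrap j i)%:Z))
    (mpolyX k (residue_mono j)).
  by apply: gradedX => i i'; rewrite !pairdeg_residue; lia.
have gq := gradedXn (n := q) gf.
have gjq := gradedM gj gq.
by apply: (graded_eq gjq) => i i'; rewrite !addNr.
Qed.

(** Injectivity is read off the coefficients, the Frobenius of [k] being injective. Surjectivity is
    checked on monomials, by [residue_division] and [q]-th roots of the coefficients. *)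
Lemma frob_root_decomposition (n : nat) (res : 'I_n -> residue)
    (M : 'I_n -> lmodType R) (phi : forall l, M l -> P) :
  bijective res ->
  (forall l, realizes (fun i => (residue_wrap (res l) i)%:Z) (phi l)) ->
  iso_direct_sum (frob_root (segre_pchar t chark) e) M.
Proof.
move=> [ser resK serK] rM; pose N := frob_root (segre_pchar t chark) e.
have phi_graded l x : graded (fun i => (residue_wrap (res l) i)%:Z) (phi l x).
  by have [_ _ _ phiP] := rM l; apply/phiP; exists x.
have emb l : exists f : {linear M l -> N}, forall x,
    segre_val (f x : R) = mpolyX k (residue_mono (res l)) * (phi l x) ^+ q.
  have [phiD phiZ _ _] := rM l.
  have [f fE] : {f : M l -> N & forall x,
      segre_val (f x : R) = mpolyX k (residue_mono (res l)) * (phi l x) ^+ q}.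
    apply: (boolp.choice (P := fun x y =>
      segre_val (y : R) = mpolyX k (residue_mono (res l)) * (phi l x) ^+ q)) => x.
    by apply: segre_of; apply: residue_frob_graded.
  have [g gE] : exists g : {linear M l -> N}, g =1 f.
    (* The [q]-th power is additive and turns a scalar [a] into [a ^+ q], which is how [a] acts on
       the module of roots. *)
    apply: linear_pack => a x y; apply: val_inj => /=.
    rewrite fE phiD phiZ (pchar_exprD e pchar_mpoly) exprMn mulrDr mulrCA -!fE.
    have -> : segre_val a ^+ q = segre_val (a ^+ q).
      by elim: (q) => [|s IH]; rewrite ?expr0 // !exprS segre_valM IH.
    by rewrite -segre_valM -segre_valD.
  by exists g => x; rewrite gE fE.
pose f l := projT1 (cid (emb l)).
have fE l x : segre_val (f l x : R) =
    mpolyX k (residue_mono (res l)) * (phi l x) ^+ q.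
  exact: (projT2 (cid (emb l))).
have sumE (x : forall l, M l) : segre_val (\sum_(l < n) f l (x l) : R) =
    \sum_(l < n) mpolyX k (residue_mono (res l)) * (phi l (x l)) ^+ q.
  by rewrite (big_morph _ (@segre_valD k t) (erefl _)); apply: eq_bigr => l _.
have coefE (x : forall l, M l) l m :
    mcoeff (mnm_add (mnm_muln m q) (residue_mono (res l)))
      (segre_val (\sum_(l < n) f l (x l) : R)) = (mcoeff m (phi l (x l))) ^+ q.
  rewrite sumE raddf_sum /= (bigD1 l) //= big1 => [|l' l'l].
    rewrite mcoeff_residue_frob; try exact: residue_mono_lt.
    by rewrite eqxx mul1r addr0.
  rewrite mcoeff_residue_frob; try exact: residue_mono_lt.
  rewrite (inj_eq (residue_mono_inj t_gt0)) (inj_eq (can_inj resK)).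
  by rewrite (negbTE l'l) mul0r.
exists f; apply: bijective_of => [x y xy|y].
  apply: functional_extensionality_dep => l.
  have [_ _ phiI _] := rM l; apply: phiI; apply/mpolyP => m.
  by apply: (pchar_expr_inj (e := e) chark); rewrite -!coefE xy.
suff hit g : graded (fun=> 0) g ->
    exists x : forall l, M l, segre_val (\sum_(l < n) f l (x l) : R) = g.
  have [x xy] := hit _ (segre_val_graded (r := y : R)).
  by exists x; apply: val_inj.
move=> gg; rewrite (mpolyE g) big_seq; elim/big_ind: _ => [|g1 g2 [x1 <-] [x2 <-]|m mg].
- by exists (fun l => 0); rewrite big1 // => l _; rewrite linear0.
- exists (fun l => x1 l + x2 l); rewrite -segre_valD; congr segre_val.
  by rewrite -big_split; apply: eq_bigr => l _; rewrite linearD.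
have [j [m' [bm' mE]]] := residue_division frob_q_gt0 (gg _ mg).
have [c cE] := closed_field_root (mcoeff m g) frob_q_gt0.
have [_ _ _ phiP] := rM (ser j).
have [x xE] : exists x, phi (ser j) x = c *: mpolyX k m'.
  by apply/phiP; rewrite serK; apply: gradedZ; exact: gradedX.
exists (dfwith (fun l => 0 : M l) (ser j) x).
rewrite (bigD1 (ser j)) //= dfwithin big1 ?addr0 => [|l lj]; last first.
  by rewrite dfwithout 1?eq_sym // linear0.
by rewrite fE xE serK exprZn cE mpolyXn -scalerAr -mpolyXD addmC mE.
Qed.

End FrobeniusDecomposition.

(** * Multiplicities and their limits *)

Section Counting.
Local Open Scope nat_scope.

(** Subsets of {0, ..., n} with [a + b + 1] elements, sorted by the element [i] that has [a] smaller
    ones. The proof is by Pascal's rule. *)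
Lemma sum_bin_bin n a b :
  \sum_(0 <= i < n.+1) 'C(i, a) * 'C(n - i, b) = 'C(n.+1, a + b.+1).
Proof.
elim: b n => [|b IHb] n.
  under eq_bigr do rewrite bin0 muln1.
  rewrite addn1; elim: n => [|n IHn].
    by rewrite big_nat1; case: a => [|a] //; rewrite !bin_small.
  by rewrite big_nat_recr //= IHn binS.
elim: n => [|n IHn]; first by rewrite big_nat1 subn0 bin0n muln0 bin_small //; lia.
rewrite big_nat_recr //= subnn bin0n muln0 addn0.
rewrite (@eq_big_nat _ _ _ _ _ _
  (fun i => 'C(i, a) * 'C(n - i, b.+1) + 'C(i, a) * 'C(n - i, b))); last first.
  by move=> i /andP[_ iln]; rewrite subSn // binS mulnDr.
by rewrite big_split /= IHn IHb addnS binS addnS.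
Qed.

Lemma leq_expnl m n k : m <= n -> m ^ k <= n ^ k.
Proof. by case: k => // k mn; rewrite leq_exp2r. Qed.

Lemma ffact_le_expn n m : n ^_ m <= n ^ m.
Proof.
elim: m n => [|m IH] n; first by rewrite ffactn0.
by rewrite ffactnS expnS leq_mul2l (leq_trans (IH _)) ?orbT // leq_expnl ?leq_pred.
Qed.

Lemma expn_le_ffact n m : n.+1 ^ m <= (n + m) ^_ m.
Proof.
elim: m => [|m IH]; first by rewrite ffactn0.
by rewrite addnS ffactSS expnS leq_mul // ltnS leq_addr.
Qed.

(** A Riemann sum for q^(a+b+1) times the Beta integral B(a+1, b+1). *)
Definition beta_sum q a b := \sum_(0 <= D < q) (q.-1 - D) ^ a * D.+1 ^ b.

(** Powers dominate falling factorials, whose sum is evaluated exactly by [sum_bin_bin]. For small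
    [q] the truncated subtraction makes the left side 0. *)
Lemma beta_sum_ge q a b :
  a`! * b`! * (q - (a + b).+1) ^ (a + b).+1 <= (a + b).+1`! * beta_sum q a b.
Proof.
case: q => [|q]; first by rewrite sub0n exp0n // muln0.
apply: leq_trans (_ : a`! * b`! * (q.+1 ^_ (a + b).+1) <= _).
  rewrite leq_mul2l; apply/orP; right.
  have [qs|qs] := ltnP q.+1 (a + b).+1; first by rewrite (eqP (ltnW qs)) exp0n.
  apply: leq_trans (_ : _ <= (q.+1 - (a + b).+1).+1 ^ (a + b).+1) _.
    by rewrite leq_exp2r.
  by apply: leq_trans (expn_le_ffact _ _) _; rewrite subnK.
have -> : a`! * b`! * q.+1 ^_ (a + b).+1 =
    (a + b).+1`! * \sum_(0 <= D < q.+1) (q - D) ^_ a * D ^_ b.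
  rewrite -bin_ffact mulnA [RHS]mulnC; congr (_ * _).
  rewrite (_ : (a + b).+1 = b + a.+1); last by lia.
rewrite -sum_bin_bin big_distrr /=.
  by apply: eq_bigr => D _; rewrite -!bin_ffact; ring.
rewrite leq_mul2l; apply/orP; right; apply: leq_sum => D _.
rewrite leq_mul ?ffact_le_expn // (leq_trans (ffact_le_expn _ _)) //.
exact: leq_expnl.
Qed.

(** Here powers are bounded by falling factorials with shifted base, which turn the sum into a part
    of the sum in [sum_bin_bin] for [n = q + a + b]. *)
Lemma beta_sum_le q a b :
  (a + b).+1`! * beta_sum q a b <= a`! * b`! * (q + (a + b).+1) ^ (a + b).+1.
Proof.
case: q => [|q]; first by rewrite /beta_sum big_geq // muln0.
apply: leq_trans (_ : _ <= a`! * b`! * (q + a + b).+1 ^_ (a + b).+1) _; last first.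
  rewrite leq_mul2l; apply/orP; right; apply: leq_trans (ffact_le_expn _ _) _.
  by rewrite leq_exp2r //; lia.
rewrite -bin_ffact mulnA mulnC leq_mul2r; apply/orP; right.
apply: leq_trans (_ : _ <= \sum_(0 <= D < q.+1) (q - D + a) ^_ a * (D + b) ^_ b) _.
  apply: leq_sum => D _; rewrite leq_mul ?expn_le_ffact //.
  apply: leq_trans (expn_le_ffact _ _).
  exact: leq_expnl.
rewrite (_ : (a + b).+1 = b + a.+1); last by lia.
rewrite -sum_bin_bin big_distrr /=.
have bq : b <= b + q.+1 by rewrite leq_addr.
have bqa : b + q.+1 <= (q + a + b).+1 by lia.
(* Only the indices from [b] to [b + q] are kept. *)
rewrite [X in _ <= X](big_cat_nat (leq0n b) (leq_trans bq bqa)) /=.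
rewrite [X in _ <= _ + X](big_cat_nat bq bqa) /=.
apply: leq_trans (leq_addl _ _); apply: leq_trans (leq_addr _ _).
have shift F : \sum_(b <= i < b + q.+1) F i = \sum_(0 <= i < q.+1) F (i + b).
  by rewrite -{1}[b]add0n big_addn addKn.
rewrite shift.
rewrite [X in X <= _]big_nat [X in _ <= X]big_nat.
apply: leq_sum => D /andP[_ Dq]; rewrite -!bin_ffact.
have -> : q + a + b - (D + b) = q - D + a by lia.
by apply: eq_leq; ring.
Qed.

Lemma sum_ltn_const q D : \sum_(x < q) (D < x) = q.-1 - D.
Proof.
elim: q => [|q IH]; first by rewrite big_ord0.
by rewrite big_ord_recr /= IH; lia.
Qed.

Lemma sum_leq_const q D : D < q -> \sum_(x < q) (x <= D) = D.+1.
Proof.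
have -> : \sum_(x < q) (x <= D) = minn q D.+1.
  elim: q => [|q IH]; first by rewrite big_ord0 min0n.
  by rewrite big_ord_recr /= IH; lia.
by lia.
Qed.

(** Once [D] is fixed the [r_i] are independent: [q - 1 - D] values exceed [D] and [D + 1] do
    not. *)
Lemma card_residue_pattern t q (beta : 'I_t -> bool) :
  #|[set j : 'I_q * {ffun 'I_t -> 'I_q} |
      [forall i, residue_wrap j i == beta i]]|
  = beta_sum q #|beta| (t - #|beta|).
Proof.
rewrite cardsE -sum1_card big_mkcond /=.
rewrite -(pair_bigA _ (fun D r => if [forall i, residue_wrap (D, r) i == beta i] then 1 else 0)) /=.
rewrite /beta_sum big_mkord; apply: eq_bigr => D _.
transitivity (\sum_(r : {ffun 'I_t -> 'I_q}) \prod_i ((D < r i) == beta i : nat)).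
  apply: eq_bigr => r _; rewrite /residue_wrap /=; case: forallP => [all_eq|].
    by rewrite big1 // => i _; rewrite all_eq.
  by move=> /forallP; rewrite negb_forall => /existsP[i /negbTE ni];
    rewrite (bigD1 i) //= ni.
(* The sum over all [r] of a product of indicators is the product over [i] of the sums over single
   values. *)
rewrite -(bigA_distr_bigA (fun i (x : 'I_q) => ((D < x) == beta i : nat))).
rewrite (bigID beta) /=; congr (_ * _).
  rewrite -prod_nat_const; apply: eq_bigr => i bi.
  by rewrite bi -(sum_ltn_const q D); apply: eq_bigr => x _; rewrite eqb_id.
have -> : t - #|beta| = #|[predC beta]|.
  have beta_t : #|beta| <= t by have := max_card beta; rewrite card_ord.
  by apply/eqP; rewrite -(eqn_add2l #|beta|) cardC card_ord subnKC.
rewrite -prod_nat_const.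
apply: eq_big => // i /negbTE nbi; rewrite nbi -[RHS](sum_leq_const (ltn_ord D)).
by apply: eq_bigr => x _; rewrite eqbF_neg -leqNgt.
Qed.

End Counting.

(** * The limit of the normalized counts *)

Section BetaLimit.
Import classical_sets filter.
Local Open Scope classical_set_scope.
Variable R : realType.

(** With [q = p ^ e], the quotient is squeezed between c (1 - m/q)^m and c (1 + m/q)^m, where c = a!
    b!/m!. *)
Lemma cvg_beta_sum (p a b : nat) : (1 < p)%N ->
  ((beta_sum (p ^ e) a b)%:R / p%:R ^+ (e * (a + b).+1) : R) @[e --> \oo]
  --> (1 / ('C(a + b, b)%:R * (a + b).+1%:R) : R).
Proof.
move=> p_gt1; set m := (a + b).+1.
have p_neq0 : p%:R != 0 :> R by rewrite pnatr_eq0; lia.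
have q_gt0 e : 0 < p%:R ^+ e :> R by rewrite exprn_gt0 // ltr0n; lia.
pose c : R := (a`! * b`!)%:R / m`!%:R.
have fact_neq0 s : (s`!)%:R != 0 :> R by rewrite pnatr_eq0 -lt0n fact_gt0.
have -> : 1 / ('C(a + b, b)%:R * m%:R) = c.
  have : ('C(a + b, b) * (b`! * a`!))%:R = (a + b)`!%:R :> R.
    by rewrite -[X in (_ * (_ * X`!))%N](addnK b a) bin_fact // leq_addl.
  rewrite /c /m factS !natrM => <-.
  have : 'C(a + b, b)%:R != 0 :> R by rewrite pnatr_eq0 -lt0n bin_gt0 leq_addl.
  have := fact_neq0 a; have := fact_neq0 b => b0 a0 C0.
  have m0 : (a + b).+1%:R != 0 :> R by rewrite pnatr_eq0.
  move: a0 b0 C0 m0.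
  move: (a`!%:R : R) (b`!%:R : R) ('C(a + b, b)%:R : R) ((a + b).+1%:R : R).
  by move=> x y z w x0 y0 z0 w0; field; rewrite x0 y0 z0 w0.
have cvg_bound (s : R) : (c * (1 + s * (p%:R^-1) ^+ e) ^+ m : R) @[e --> \oo] --> c.
  have z0 : ((p%:R^-1) ^+ e : R) @[e --> \oo] --> (0 : R).
    apply: cvg_expr; rewrite ger0_norm ?invr_ge0 ?ler0n //.
    by rewrite invf_lt1 ?ltr1n // ltr0n; lia.
  have z1 : (1 + s * (p%:R^-1) ^+ e : R) @[e --> \oo] --> (1 + s * 0 : R).
    by apply: cvgD; [exact: cvg_cst | exact: cvgMl_tmp].
  have : (c * (1 + s * (p%:R^-1) ^+ e) ^+ m : R) @[e --> \oo]
      --> (c * (1 + s * 0) ^+ m : R).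
    by apply: cvgMl_tmp; exact: (cvg_comp _ _ z1 (@exprn_continuous R m _)).
  by rewrite mulr0 addr0 expr1n mulr1.
apply: (squeeze_cvgr _ (cvg_bound (- m%:R)) (cvg_bound m%:R)).
have normalize (e : nat) (s : R) : c * (1 + s * (p%:R^-1) ^+ e) ^+ m =
    (a`! * b`!)%:R * (p%:R ^+ e + s) ^+ m / m`!%:R / p%:R ^+ (e * m).
  have -> : 1 + s * (p%:R^-1) ^+ e = (p%:R ^+ e + s) / p%:R ^+ e.
    by rewrite exprVn mulrDl divff ?gt_eqF.
  by rewrite expr_div_n -exprM /c; field; rewrite fact_neq0 expf_neq0.
near=> e; rewrite !normalize.
(* For such [e] the truncated subtraction in [beta_sum_ge] agrees with that of [R]. *)
have m_le : (m <= p ^ e)%N.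
  apply: leq_trans (_ : e <= _)%N; last exact/ltnW/ltn_expl.
  by near: e; exact: nbhs_infty_ge.
have fact_pos : 0 < m`!%:R :> R by rewrite ltr0n fact_gt0.
have qm_pos : 0 < p%:R ^+ (e * m) :> R by exact: q_gt0.
rewrite ler_pM2r ?invr_gt0 // ler_pM2r ?invr_gt0 //.
rewrite ler_pdivrMr // ler_pdivlMr // ![_%:R * m`!%:R]mulrC.
rewrite -natrX -natrB // -natrD -!natrX -!natrM !ler_nat.
by rewrite beta_sum_ge beta_sum_le.
Unshelve. all: by end_near. Qed.

End BetaLimit.

(** * Multiplicities and signatures of a weight class *)

Section Multiplicity.
Variables (R : realType) (k : closedFieldType) (p : nat) (chark : p \in [pchar k]).
Variables (t : nat) (t_gt0 : (0 < t)%N).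
Variables (M : lmodType (segre k t)) (w : 'I_t -> int) (phi : M -> mpoly (t + t) k).
Hypothesis rM : realizes w phi.

Definition residues_of_class (q : nat) : {set 'I_q * {ffun 'I_t -> 'I_q}} :=
  [set j | `[< forall i i', (residue_wrap j i)%:Z - w i =
                            (residue_wrap j i')%:Z - w i' >]].

(** The decomposition over all residues gives existence. For uniqueness, any other decomposition is
    compared with it by [direct_sum_count_le] in both directions. *)
Lemma is_multiplicity_residues e :
  is_multiplicity R chark M e #|residues_of_class (p ^ e)|.
Proof.
have exist_phi (a : 'I_t -> bool -> int) := cid (divisorial_realizes k a).
pose psi a := projT1 (exist_phi a).
have psiP a : realizes (family_weight a) (psi a) := projT2 (exist_phi a).
have isoM b := realizes_iso (psiP b) rM.
pose q := (p ^ e)%N; pose J := ('I_q * {ffun 'I_t -> 'I_q})%type.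
pose res (l : 'I_#|{: J}|) : J := enum_val l.
pose a l := residue_family (res l).
have dec : conic_decomposition R chark e a.
  split=> [l|]; first exact: residue_conic.
  apply: (frob_root_decomposition (phi := fun l => psi (a l)) chark t_gt0 (enum_val_bij _)).
  move=> l; rewrite (_ : (fun i => _) = family_weight (a l)); first exact: psiP.
  by apply/funext => i; rewrite weight_residue_family.
have count_a : summand_count a M = #|residues_of_class (p ^ e)|.
  rewrite /summand_count -(card_imset _ (@enum_val_inj _ _)).
  apply: eq_card => j; apply/imsetP/idP => [[l + ->]|].
    rewrite !finset.in_set => /asboolP h; have iso_l := (isoM (a l)).1 h.
    by apply/asboolP => i i'; have := iso_l i i'; rewrite !weight_residue_family.
  rewrite finset.in_set => /asboolP jw; exists (enum_rank j); last by rewrite enum_rankK.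
  rewrite finset.in_set; apply/asboolP; apply: (isoM (a _)).2 => i i'.
  by rewrite !weight_residue_family /res enum_rankK.
(* A monomial of weight [w] detects the class: a summand is isomorphic to [M] exactly when [m] is
   balanced for its weight. *)
have [m bm] := balanced_exists w.
have countE n (b : 'I_n -> 'I_t -> bool -> int) : summand_count b M =
    #|[set l | `[< balanced (family_weight (b l)) m >]]%SET|.
  apply: eq_card => l; rewrite !finset.in_set; apply/asboolP/asboolP.
    by move=> h; have bw := (isoM (b l)).1 h; apply: balanced_eq bm _ => i i';
      have := bw i i'; lia.
  move=> bm'; apply: (isoM (b l)).2 => i i'.
  by have := bm i i'; have := bm' i i'; lia.
split; first by exists #|{: J}|, a.
move=> n b [_ dec_b]; rewrite -count_a !countE; apply/eqP; rewrite eqn_leq.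
have [_ dec_a] := dec.
apply/andP; split.
  exact: (direct_sum_count_le m (fun l => psiP (a l)) (fun l => psiP (b l)) dec_a dec_b).
exact: (direct_sum_count_le m (fun l => psiP (b l)) (fun l => psiP (a l)) dec_b dec_a).
Qed.

Lemma pchar_gt1 : (1 < p)%N.
Proof. by move: chark; rewrite inE => /andP[/prime_gt1]. Qed.

(** A pattern taking both values is the only 0/1 vector in its class. The shift [c] admits weights
    with entries 0 and -1. *)
Lemma is_gen_Fsignature_pattern (beta : 'I_t -> bool) (c : int) i0 i1 :
  ~~ beta i0 -> beta i1 -> (forall i, w i = (beta i)%:Z + c) ->
  is_gen_Fsignature chark M
    (1 / ('C(t, #|beta|)%:R * t.+1%:R) : R).
Proof.
move=> b0 b1 wE; exists (fun e => #|residues_of_class (p ^ e)|).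
split=> [e|]; first exact: is_multiplicity_residues.
have beta_t : (#|beta| <= t)%N by have := max_card beta; rewrite card_ord.
have := @cvg_beta_sum R p #|beta| (t - #|beta|) pchar_gt1.
rewrite subnKC // bin_sub //.
suff cardE e : #|residues_of_class (p ^ e)| = beta_sum (p ^ e) #|beta| (t - #|beta|).
  by under eq_fun do rewrite -cardE.
rewrite -card_residue_pattern; apply: eq_card => j; rewrite !finset.in_set.
apply/asboolP/forallP => [jw i|jb i i'].
  (* The entries at [i0] and [i1] must differ by 1, which forces 0 and 1 there and leaves no room
     for a constant shift. *)
  have := jw i i0; have := jw i i1; rewrite !wE (negbTE b0) b1.
  by case: (residue_wrap j i); case: (residue_wrap j i0);
    case: (residue_wrap j i1); case: (beta i) => //=; lia.
by rewrite !wE (eqP (jb i)) (eqP (jb i')); lia.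
Qed.

(** The class of 0 contains the two constant patterns, each contributing 1/(t + 1). *)
Lemma is_gen_Fsignature_free :
  (forall i, w i = 0) -> is_gen_Fsignature chark M (2 / t.+1%:R : R).
Proof.
move=> w0; exists (fun e => #|residues_of_class (p ^ e)|).
split=> [e|]; first exact: is_multiplicity_residues.
have -> : 2 / t.+1%:R =
    1 / ('C(t, t)%:R * t.+1%:R) + 1 / ('C(t, 0)%:R * t.+1%:R) :> R.
  by rewrite binn bin0 !mul1r -mulr2n mulr_natl.
suff cardE e : #|residues_of_class (p ^ e)| =
    (beta_sum (p ^ e) 0 t + beta_sum (p ^ e) t 0)%N.
  rewrite (_ : (fun e => _) = fun e =>
    (beta_sum (p ^ e) 0 t)%:R / p%:R ^+ (e * t.+1) +
    (beta_sum (p ^ e) t 0)%:R / p%:R ^+ (e * t.+1)).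
    apply: cvgD; first exact: (@cvg_beta_sum R p 0 t pchar_gt1).
    by have := @cvg_beta_sum R p t 0 pchar_gt1; rewrite addn0.
  by apply/funext => e; rewrite cardE natrD mulrDl.
pose i0 := Ordinal t_gt0.
have card_const (b : bool) : #|[set j : 'I_(p ^ e) * {ffun 'I_t -> 'I_(p ^ e)} |
    [forall i, residue_wrap j i == b]]| =
    beta_sum (p ^ e) (if b then t else 0) (if b then 0 else t).
  rewrite (card_residue_pattern _ (fun=> b)); case: b.
    by rewrite (eq_card (B := predT)) // card_ord subnn.
  by rewrite (eq_card (B := pred0)) // card0 subn0.
rewrite -(card_const false) -(card_const true) -cardsUI.
rewrite [X in (_ + X)%N]eq_card0 ?addn0; last first.
  move=> j; rewrite finset.in_setI !finset.in_set; apply/negP.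
  by move=> /andP[/forallP/(_ i0)/eqP j0 /forallP/(_ i0)]; rewrite j0.
apply: eq_card => j; rewrite finset.in_setU !finset.in_set; apply/asboolP/orP => [jw|].
  case j0: (residue_wrap j i0); [right|left]; apply/forallP => i;
    have := jw i i0; rewrite !w0 j0; case: (residue_wrap j i) => //=; lia.
by case=> /forallP jb i i'; rewrite !w0 (eqP (jb i)) (eqP (jb i')).
Qed.

End Multiplicity.

(** * Weights of the classes in the theorem *)

Lemma weight_class_family (t : nat) (c : 'I_t.-1 -> int) (i : 'I_t) :
  family_weight (class_family c) i = oapp c 0 (insub (val i)).
Proof. by rewrite /family_weight /class_family add0r. Qed.

Lemma card_block_class (t u v : nat) (d : int) (s : {perm 'I_t.-1}) :
  (0 < t)%N -> (u + v = t.-1)%N -> d != 0 ->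
  #|[pred i | family_weight (class_family (fun i => block_vector u d (s i))) i == d]|
  = v.
Proof.
(* The last index carries no coordinate of the class, so its weight is 0 and it is not counted. *)
case: t s => // t s _ /= uv d0; rewrite -sum1_card big_mkcond big_ord_recr /=.
rewrite unfold_in /= weight_class_family insubF ?ltnn //= eq_sym (negbTE d0) addn0.
transitivity (\sum_(i < t) (u <= s i)%N)%N.
  apply: eq_bigr => i _; rewrite unfold_in /= weight_class_family /= insubT //= => it.
  rewrite (_ : Sub _ _ = i) /block_vector; last exact: val_inj.
  by case: (ltnP (s i) u); rewrite ?eqxx // eq_sym (negbTE d0).
have -> : (\sum_(i < t) (u <= s i) = \sum_(i < t) (u <= i))%N.
  by rewrite [RHS](reindex_inj (h := s)) //; exact: perm_inj.
rewrite -(big_mkord xpredT (fun i => (u <= i)%N : nat)) -uv.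
rewrite (big_cat_nat (n := u)) ?leq_addr //= big_nat big1 => [|i /andP[_ iu]]; last by lia.
rewrite add0n big_nat (eq_bigr (fun=> 1%N)) => [|i /andP[ui _]]; last by rewrite ui.
by rewrite -big_nat sum_nat_const_nat muln1 addKn.
Qed.

Theorem proposition6p1 (R : realType) (k : closedFieldType) (p : nat)
    (chark : p \in [pchar k]) (t : nat) (t_ge2 : (2 <= t)%N) :
  (forall u v : nat, (0 < v)%N -> (u + v = t.-1)%N ->
     forall s : {perm 'I_t.-1},
       is_gen_Fsignature chark (class_ideal k (fun i => block_vector u 1 (s i)))
         (1 / ('C(t, v)%:R * t.+1%:R) : R) /\
       is_gen_Fsignature chark (class_ideal k (fun i => block_vector u (-1) (s i)))
         (1 / ('C(t, v)%:R * t.+1%:R) : R)) /\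
  is_gen_Fsignature chark (class_ideal k (fun _ : 'I_t.-1 => 0))
    (2 / t.+1%:R : R) /\
  is_Fsignature t chark (2 / t.+1%:R : R).
Proof.
have t_gt0 : (0 < t)%N by lia.
split=> [u v v_gt0 uv s|]; last split.
- pose w d := family_weight (class_family (fun i => block_vector u d (s i))).
  have wE d i : w d i = (w d i == d)%:Z * d.
    have zeroE : 0 = (0 == d)%:Z * d by case: eqP => [<-|_]; rewrite ?mulr0 ?mul0r.
    rewrite /w weight_class_family; case: insub => [j|] //=.
    by rewrite /block_vector; case: ifP => // _; rewrite eqxx mul1r.
  have t1_lt : (t.-1 < t)%N by lia.
  (* The last pair always has weight 0, which supplies the second value of the pattern even when
     [u = 0]. *)
  pose last_i := Ordinal t1_lt.
  have w_last d : w d last_i = 0.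
    by rewrite /w weight_class_family insubF //= ltnn.
  have card_w d := card_block_class s t_gt0 uv (d := d).
  have w_ex d : d != 0 -> exists i, w d i == d.
    by move=> /card_w wv; have /card_gt0P [i] : (0 < #|[pred i | w d i == d]|)%N;
      [rewrite wv | rewrite inE; exists i].
  split.
    have [phi rphi] := divisorial_realizes k (class_family (fun i => block_vector u 1 (s i))).
    have [i1 wi1] := w_ex 1 isT.
    pose beta i := w 1 i == 1.
    have card_beta : #|beta| = v by exact: card_w.
    rewrite -card_beta.
    apply: (is_gen_Fsignature_pattern R chark t_gt0 rphi (i0 := last_i) (i1 := i1) (c := 0)) => //.
      by rewrite /beta w_last.
    by move=> i; rewrite addr0 -/(w 1) {1}wE mulr1.
  have [phi rphi] := divisorial_realizes k (class_family (fun i => block_vector u (-1) (s i))).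
  have [i1 wi1] := w_ex (-1) isT.
  have v_le : (v <= t)%N by lia.
  (* Adding 1 to the weights gives a 0/1 pattern with [t - v] ones; the symmetry of binomial
     coefficients restores [v]. *)
  pose beta i := w (-1) i != -1.
  have card_beta : #|beta| = (t - v)%N.
    apply/eqP; rewrite -(eqn_add2l v) subnKC // -{1}(card_w (-1) isT).
    by rewrite -[t in X in _ == X]card_ord -(cardC [pred i | w (-1) i == -1]).
  rewrite -(bin_sub v_le) -card_beta.
  apply: (is_gen_Fsignature_pattern R chark t_gt0 rphi (i0 := i1) (i1 := last_i) (c := -1)).
  - by rewrite /beta wi1.
  - by rewrite /beta w_last.
  - by move=> i; rewrite -/(w (-1)) {1}wE /beta; case: (w (-1) i == -1).
- have [phi rphi] := divisorial_realizes k (class_family (fun _ : 'I_t.-1 => 0)).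
  apply: (is_gen_Fsignature_free R chark t_gt0 rphi) => i.
  by rewrite weight_class_family; case: insub.
- exact: (is_gen_Fsignature_free R chark t_gt0 (segre_realizes k t)).
Qed.
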